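(* Let $p=\sum_{i=1}^n a_i x_i$ be a pattern. The following conditions are equivalent: (i) there exists a numerical semigroup that admits $p$; (ii) $\mathbb{N}$ admits $p$; (iii) $\sum_{i=1}^{n'} a_i\geq 0$ for all $n'$ with $1\le n'\leq n$.
   Context: $\mathbb{N}$ denotes the set of nonnegative integers. A numerical semigroup is a subset of $\mathbb{N}$ that contains $0$, is closed under addition and has finite complement in $\mathbb{N}$. A pattern of length $n$ is a linear homogeneous polynomial $p=\sum_{i=1}^n a_ix_i$ in $x_1,\dots,x_n$ all of whose coefficients $a_1,\dots,a_n$ are non-zero integers (for $n=0$ the unique pattern is $p=0$). A numerical semigroup $\Lambda$ admits a pattern $p$ of length $n$ if for all $s_1,\dots,s_n\in\Lambda$ with $s_1\geq s_2\geq\dots\geq s_n$, the integer $p(s_1,\dots,s_n)$ belongs to $\Lambda$. *)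

(* Defs.v *)
From mathcomp Require Import all_boot all_order all_algebra.
From mathcomp Require Import classical_sets cardinality.
From mathcomp Require Import mpoly.

Set Implicit Arguments.
Unset Strict Implicit.
Unset Printing Implicit Defensive.

Import GRing.Theory Num.Theory.

Record numerical_semigroup (L : set nat) : Prop := NumericalSemigroup {
  numsg0 : L 0%N;
  numsgD : forall x y : nat, L x -> L y -> L (x + y)%N;
  numsg_cofinite : finite_set (~` L)%classic
}.

Local Open Scope ring_scope.

Definition linear_form (n : nat) (a : 'I_n -> int) : {mpoly int[n]} :=
  \sum_(i < n) a i *: 'X_i.

Definition is_pattern (n : nat) (p : {mpoly int[n]}) (a : 'I_n -> int) : Prop :=
  p = linear_form a /\ forall i, a i != 0.

(* [p] takes values in [int], so that membership in [L] also asserts that the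
   value is nonnegative. *)
Definition admits (n : nat) (L : set nat) (p : {mpoly int[n]}) : Prop :=
  forall s : 'I_n -> nat,
    (forall i, L (s i)) ->
    (forall i j : 'I_n, (i <= j)%N -> (s j <= s i)%N) ->
    exists2 m : nat, L m & p.@[fun i => (s i)%:Z] = m%:Z.

(* Main.v *)
(** For the necessity of (iii), evaluate at [t, ..., t, 0, ..., 0] with [t] a
    positive element of the semigroup: the value is [t] times a partial sum of
    the coefficients. For its sufficiency, slice a nonincreasing sequence into
    its superlevel sets, each of which is an initial segment of the indices:
    the value of the form is then a sum of partial sums of the coefficients. *)
Require Import Defs.
From mathcomp Require Import all_boot all_order all_algebra.
From mathcomp Require Import classical_sets cardinality.
From mathcomp Require Import mpoly.

Import GRing.Theory Num.Theory.

Local Open Scope ring_scope.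

Lemma meval_linear_form (n : nat) (a v : 'I_n -> int) :
  (linear_form a).@[v] = \sum_(i < n) a i * v i.
Proof.
rewrite /linear_form raddf_sum; apply: eq_bigr => i _.
by rewrite /= mevalZ mevalXU.
Qed.

(** Otherwise the complement of [L] together with [0] would be all of [nat], which would then be
    finite. *)
Lemma numerical_semigroup_pos (L : set nat) :
  numerical_semigroup L -> exists2 t : nat, (0 < t)%N & L t.
Proof.
case=> _ _ finL; apply: boolp.contrapT => noL.
apply: infinite_nat; have := finite_setU (~` L) [set 0%N].
set U := (_ `|` _)%classic => finU.
have -> : [set: nat]%classic = U; last by rewrite finU; split=> //; exact: finite_set1.
apply/seteqP; split=> // -[|t] _; first by right.
by left=> Lt; apply: noL; exists t.+1.
Qed.

Lemma numerical_semigroup_setT : numerical_semigroup [set: nat]%classic.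
Proof. by split=> //; rewrite setCT; exact: finite_set0. Qed.

(** Meant for the superlevel sets of a nonincreasing sequence. The bound [m] is one more than the
    largest index satisfying [P], or [0] if there is none. *)
Lemma downset_ord (n : nat) (P : pred 'I_n) :
  (forall i j : 'I_n, (i <= j)%N -> P j -> P i) ->
  exists2 m : nat, (m <= n)%N & forall i, P i = (i < m)%N.
Proof.
move=> downP; case: (pickP P) => [i0 Pi0|P0]; last by exists 0%N.
case: (arg_maxnP (fun i : 'I_n => i : nat) Pi0) => i Pi maxi.
exists i.+1 => // j; apply/idP/idP => [Pj|]; first exact: maxi.
by rewrite ltnS => /downP; apply.
Qed.

(** Leaving [M] free lets all terms of a sequence be sliced over one common range of levels, so that
    the two sums can be exchanged. *)
Lemma nat_layers (R : pzSemiRingType) (x M : nat) :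
  (x <= M)%N -> x%:R = \sum_(t < M) (t < x)%:R :> R.
Proof.
move=> xM; rewrite -natr_sum -big_mkcond /=.
by rewrite -(big_ord_widen M (fun=> 1%N) xM) sum1_card card_ord.
Qed.

Lemma sum_nonincreasing_ge0 (R : numDomainType) (n : nat) (a : 'I_n -> R)
    (s : 'I_n -> nat) :
  (forall m : nat, (1 <= m <= n)%N -> 0 <= \sum_(i < n | (i < m)%N) a i) ->
  (forall i j : 'I_n, (i <= j)%N -> (s j <= s i)%N) ->
  0 <= \sum_(i < n) a i * (s i)%:R.
Proof.
move=> a_ge0 s_dec; pose M := \max_(i < n) s i.
have -> : \sum_(i < n) a i * (s i)%:R
        = \sum_(t < M) \sum_(i < n | (t < s i)%N) a i.
  under [RHS]eq_bigr do rewrite big_mkcond.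
  rewrite exchange_big; apply: eq_bigr => i _ /=.
  rewrite (nat_layers R (s i) M) ?leq_bigmax // mulr_sumr.
  by apply: eq_bigr => t _; rewrite mulr_natr mulrb.
apply: sumr_ge0 => t _.
have [i j /s_dec le_s /leq_trans|m m_le_n sE] := downset_ord n (fun i => t < s i)%N.
  exact.
(* The value [m = 0] is outside the range of [a_ge0], but the sum is then empty. *)
rewrite (eq_bigl _ _ sE); case: m m_le_n {sE} => [|m] m_le_n.
  by rewrite big_pred0.
exact: a_ge0.
Qed.

Theorem theorem12 (n : nat) (p : {mpoly int[n]}) (a : 'I_n -> int)
    (hp : is_pattern p a) :
  [<-> exists L : set nat, numerical_semigroup L /\ admits L p;
       admits [set: nat]%classic p;
       forall n' : nat, (1 <= n' <= n)%N -> 0 <= \sum_(i < n | (i < n')%N) a i].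
Proof.
case: hp => -> _.
set Ex := (X in [<-> X; _; _]); set Nat := (X in [<-> _; X; _]).
set Sums := (X in [<-> _; _; X]).
have Nat_Ex : Nat -> Ex.
  by exists [set: nat]%classic; split=> //; exact: numerical_semigroup_setT.
have Ex_Sums : Ex -> Sums.
  case=> L [sgL admL] m _; have [t t_gt0 Lt] := numerical_semigroup_pos L sgL.
  have [||k _] := admL (fun i => if (i < m)%N then t else 0%N).
  - by move=> i; case: ifP => // _; exact: numsg0 sgL.
  - move=> i j le_ij; case: (ltnP j m) => // lt_jm.
    by rewrite (leq_ltn_trans le_ij lt_jm).
  rewrite meval_linear_form => valE.
  (* As [t] is positive, the partial sum has the sign of its product with [t], which is the natural
     number [k]. *)
  rewrite -(@pmulr_lge0 _ t%:Z) ?ltz_nat // mulr_suml.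
  rewrite big_mkcond /= (_ : \sum_(i < n) _ = k%:Z) // -valE.
  by apply: eq_bigr => i _; case: ifP; rewrite ?mulr0.
have Sums_Nat : Sums -> Nat.
  move=> sums s _ s_dec; have := sum_nonincreasing_ge0 _ _ _ _ sums s_dec.
  rewrite meval_linear_form; under eq_bigr do rewrite natz.
  (* Nonnegativity excludes the constructor [Negz], and the argument of [Posz] is the required
     natural number. *)
  by case: (\sum_(i < n) _) => // k _; exists k.
(* The cycle needed here runs opposite to the one proved, so each of its implications is a composite
   of two. *)
by tfae; auto.
Qed.
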